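(* Let $p\ge2$, $n\ge1$, $\alpha>1$ real, and $m\in\{j/p^n:0\le j\le p^n\}$ be fixed, and let $\mathcal{B}_m$ be the set of Boolean functions $f:(\mathbb{Z}/p\mathbb{Z})^n\to\{0,1\}$ with $\mathbb{E} f=m$. (i) There exists $\epsilon_0>0$ such that for every $\epsilon\in(0,\epsilon_0)$, every $f\in\mathcal{B}_m$ maximizing $\mathbb{E}(T_\epsilon f)^\alpha$ over $\mathcal{B}_m$ satisfies $I(f)=\min\{I(g):g\in\mathcal{B}_m\}$. (ii) There exists $\epsilon_1<1-1/p$ such that for every $\epsilon\in(\epsilon_1,1-1/p)$, every $f\in\mathcal{B}_m$ maximizing $\mathbb{E}(T_\epsilon f)^\alpha$ over $\mathcal{B}_m$ satisfies $W_1(f)=\max\{W_1(g):g\in\mathcal{B}_m\}$, where $W_1(f)=\sum_{\xi:\,|\mathrm{supp}(\xi)|=1}|\hat f(\xi)|^2$.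
   Context: $(\mathbb{Z}/p\mathbb{Z})^n$ carries the uniform measure; $X$ is a uniform random element. For $0\le\epsilon\le1-1/p$, the noise operator is $T_\epsilon f(x)=\mathbb{E} f(x+Z)$, where $Z$ has independent coordinates, each equal to $0$ with probability $1-\epsilon$ and to each nonzero element of $\mathbb{Z}/p\mathbb{Z}$ with probability $\epsilon/(p-1)$. Let $e_p(\theta)=e^{2\pi i\theta/p}$, $\hat f(\xi)=\mathbb{E}[f(X)\overline{e_p(\xi\cdot X)}]$, $\mathrm{supp}(\xi)=\{j:\xi_j\ne0\}$. For $j\in[n]$, let $\tilde Z_j$ be uniform on $(\mathbb{Z}/p\mathbb{Z})\setminus\{0\}$ independent of $X$, $\tilde\sigma_j(x)=(x_1,\dots,x_j+\tilde Z_j,\dots,x_n)$, $I_j(f)=\mathbb{P}(f(X)\ne f(\tilde\sigma_j(X)))$, and total influence $I(f)=\sum_jI_j(f)$. *)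

(* Defs.v *)
From HB Require Import structures.
From mathcomp Require Import all_boot all_order all_algebra.
From mathcomp Require Import all_classical all_reals all_analysis.
Set Implicit Arguments. Unset Strict Implicit. Unset Printing Implicit Defensive.
Import Order.TTheory GRing.Theory Num.Theory.
Local Open Scope ring_scope.

(* The group (Z/pZ)^n, for p >= 2 (hypothesis carried by the theorem). *)
Definition cube (p n : nat) := {ffun 'I_n -> 'Z_p}.

Section Defs.
Variables (R : realType) (p n : nat).
Local Notation T := (cube p n).

Definition Ex (h : T -> R) : R := #|T|%:R^-1 * \sum_(x : T) h x.

Definition bR (f : {ffun T -> bool}) (x : T) : R := (f x)%:R.

Definition noise_prob (eps : R) (z : T) : R :=
  \prod_(i < n) (if z i == 0 then 1 - eps else eps / (p.-1)%:R).

Definition Tnoise (eps : R) (f : {ffun T -> bool}) (x : T) : R :=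
  \sum_(z : T) noise_prob eps z * bR f (x + z).

Definition noise_obj (eps alpha : R) (f : {ffun T -> bool}) : R :=
  Ex (fun x => Tnoise eps f x `^ alpha).

Definition unitv (j : 'I_n) (a : 'Z_p) : T := [ffun i => if i == j then a else 0].

Definition influence_j (f : {ffun T -> bool}) (j : 'I_n) : R :=
  Ex (fun x => (p.-1)%:R^-1 *
     \sum_(a : 'Z_p | a != 0) (f x != f (x + unitv j a))%:R).

Definition total_influence (f : {ffun T -> bool}) : R :=
  \sum_(j < n) influence_j f j.

(* xi . x as a natural number (only its residue mod p matters below) *)
Definition dotn (xi x : T) : nat := \sum_(i < n) (xi i : nat) * (x i : nat).

(* |hat f(xi)|^2 where hat f(xi) = E[f(X) conj(e_p(xi.X))]
   = E[f(X) cos(2 pi xi.X/p)] - i E[f(X) sin(2 pi xi.X/p)]. *)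
Definition fourier_sq (f : {ffun T -> bool}) (xi : T) : R :=
  let th x := 2 * pi * (dotn xi x)%:R / p%:R in
  (Ex (fun x => bR f x * cos (th x))) ^+ 2 + (Ex (fun x => bR f x * sin (th x))) ^+ 2.

Definition supp (xi : T) : {set 'I_n} := [set i | xi i != 0].

Definition W1 (f : {ffun T -> bool}) : R :=
  \sum_(xi : T | #|supp xi| == 1%N) fourier_sq f xi.

Definition is_maximizer (eps alpha m : R) (f : {ffun T -> bool}) : Prop :=
  Ex (bR f) = m /\
  forall g : {ffun T -> bool}, Ex (bR g) = m -> noise_obj eps alpha g <= noise_obj eps alpha f.

End Defs.

(* Main.v *)
(**
  Near eps = 0, T_eps f (x) ^ alpha - f x = eps * alpha * f x * D x + o(eps),
  where D x = sum_j (E f(sigma_j x) - f x); points with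
  f x = 0 contribute O(eps ^ alpha) = o(eps) since alpha > 1.  Averaging and
  using translation invariance, E (f * D) = - I(f) / 2, so that
    E (T_eps f) ^ alpha = m - (alpha / 2) I(f) eps + o(eps).
  Near eps = 1 - 1/p, put eps = (1 - 1/p)(1 - rho).  The noise kernel is the
  product over coordinates of 1/p + rho (1_{z_i = 0} - 1/p), so that
  T_eps f = m + rho f_1 + O(rho ^ 2) with E (T_eps f) = m exactly and
  E f_1 ^ 2 = W_1(f) (orthogonality of characters).  A second order expansion
  of the power function at m > 0 gives
    E (T_eps f) ^ alpha =
      m ^ alpha + (alpha (alpha - 1) / 2) m ^ (alpha - 2) W_1(f) rho ^ 2 + o(rho ^ 2).
  There are finitely many f, so in both regimes the ordering of the first
  nonconstant coefficients eventually decides the ordering of the objectives.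
*)
Require Import Defs.
From mathcomp Require Import all_boot all_order all_algebra.
From mathcomp Require Import all_classical all_reals all_analysis.
From mathcomp Require Import ring lra.
Set Implicit Arguments. Unset Strict Implicit. Unset Printing Implicit Defensive.
Import Order.TTheory GRing.Theory Num.Theory.
Local Open Scope ring_scope.
Import numFieldNormedType.Exports.
Local Open Scope classical_set_scope.

(** * One-sided limits and the product rule for slopes *)

Lemma cvg_sumr (R : realType) (T I : Type) (F : set_system T) {FF : Filter F}
    (r : seq I) (P : pred I) (u : I -> T -> R) (l : I -> R) :
  (forall i, P i -> u i t @[t --> F] --> l i) ->
  \sum_(i <- r | P i) u i t @[t --> F] --> \sum_(i <- r | P i) l i.
Proof.
move=> ul; apply: cvg_big => //.
exact: pseudometric_normed_Zmodule.add_continuous.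
Qed.

(** Where [s t != 0], [u t] equals [l + s t * ((u t - l) / s t)], and the product tends to [0 * d];
    a convergent slope thus yields convergence of [u] itself. *)
Lemma cvg_dslope (R : realType) (T : Type) (F : set_system T) {FF : Filter F}
    (s u : T -> R) (l d : R) :
  (\forall t \near F, s t != 0) ->
  s t @[t --> F] --> 0 -> (u t - l) / s t @[t --> F] --> d ->
  u t @[t --> F] --> l.
Proof.
move=> sN0 s0 ud.
have : l + s t * ((u t - l) / s t) @[t --> F] --> l + 0 * d.
  by apply: cvgD; [exact: cvg_cst | exact: cvgM].
rewrite mul0r addr0; apply: cvg_trans; apply: near_eq_cvg.
near=> t; have st : s t != 0 by near: t.
by field.
Unshelve. all: by end_near. Qed.

Lemma cvg_id_at_right (R : realType) : (t : R) @[t --> (0 : R)^'+] --> (0 : R).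
Proof. exact: (@cvg_at_right_filter R R idfun 0 0 cvg_id). Qed.

Lemma near_neq0_at_right (R : realType) : \forall t \near (0 : R)^'+, t != 0.
Proof.
by near=> t; rewrite gt_eqF//; near: t; exact: nbhs_right_gt.
Unshelve. all: by end_near. Qed.

(** Leibniz rule by induction on the list; [uniq] ensures that [j != i] drops exactly one factor. *)
Lemma cvg_dslope_prod_affine (R : realType) (I : eqType) (r : seq I)
    (c d : I -> R) : uniq r ->
  (\prod_(i <- r) (c i + t * d i) - \prod_(i <- r) c i) / t
    @[t --> (0 : R)^'+] -->
  \sum_(i <- r) d i * \prod_(j <- r | j != i) c j.
Proof.
elim: r => [_|x r IHr /= /andP[xr /IHr {}IHr]].
  rewrite !big_nil; under eq_cvg do rewrite big_nil subrr mul0r.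
  exact: cvg_cst.
have A0 : \prod_(i <- r) (c i + t * d i) @[t --> (0 : R)^'+] --> \prod_(i <- r) c i.
  exact: (cvg_dslope (near_neq0_at_right R) (@cvg_id_at_right R) IHr).
have -> : \sum_(i <- x :: r) d i * \prod_(j <- x :: r | j != i) c j =
    d x * \prod_(i <- r) c i + c x * \sum_(i <- r) d i * \prod_(j <- r | j != i) c j.
  rewrite big_cons big_cons eqxx /= mulr_sumr; congr (_ * _ + _).
    rewrite [LHS]big_seq_cond [RHS]big_seq; apply: eq_bigl => i.
    by case: (boolP (i \in r)) => //= ir; apply: contraNneq xr => <-.
  apply: eq_big_seq => i ir; rewrite big_cons ifT; first by rewrite mulrCA.
  by apply: contraNneq xr => ->.
(* With [A] the product over the tail, the slope of [(c x + t * d x) * A t] at 0 is [d x * A t] plus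
   [c x] times the slope of [A]. *)
have : d x * \prod_(i <- r) (c i + t * d i) +
    c x * ((\prod_(i <- r) (c i + t * d i) - \prod_(i <- r) c i) / t) @[t --> (0 : R)^'+] -->
   d x * \prod_(i <- r) c i + c x * \sum_(i <- r) d i * \prod_(j <- r | j != i) c j.
  by apply: cvgD; [exact: cvgMl_tmp A0|exact: cvgMl_tmp IHr].
apply: cvg_trans; apply: near_eq_cvg; near=> t.
have t0 : t != 0 by near: t; exact: near_neq0_at_right.
by rewrite !big_cons; field.
Unshelve. all: by end_near. Qed.

(** * Second-order Taylor remainder of the power function at 1 *)

(* The value at 0 makes this Taylor remainder continuous there. *)
Definition powR_rem2 (R : realType) (a v : R) : R :=
  if v == 0 then a * (a - 1) / 2 else ((1 + v) `^ a - 1 - a * v) / v ^+ 2.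

Lemma powR1D (R : realType) (a v : R) :
  (1 + v) `^ a = 1 + a * v + powR_rem2 a v * v ^+ 2.
Proof.
rewrite /powR_rem2; case: eqVneq => [->|v0].
  by rewrite addr0 powR1 mulr0 expr0n /= mulr0 !addr0.
by field.
Qed.

Lemma is_derive1_powR1D (R : realType) (a x : R) : -1 < x ->
  is_derive x 1 (fun v : R => (1 + v) `^ a) (a * (1 + x) `^ (a - 1)).
Proof.
move=> x1; have x0 : 0 < 1 + x by lra.
have H1 : is_derive x (1 : R) (fun v : R => 1 + v) 1.
  by have := is_deriveD (is_derive_cst (1 : R) x 1) (is_derive_id x (1 : R)); rewrite add0r.
have := is_derive1_comp (is_derive1_powR a x0) H1.
by rewrite mulr1.
Qed.

(** One use of l'Hôpital's rule suffices: the quotient of the derivatives is [a / 2] times the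
    difference quotient at 0 of the power of [1 + v] with exponent [a - 1], whose limit is
    [a - 1]. *)
Lemma cvg_powR_rem2 (R : realType) (a : R) :
  powR_rem2 a v @[v --> (0:R)] --> a * (a - 1) / 2.
Proof.
have rem0 : powR_rem2 a 0 = a * (a - 1) / 2 by rewrite /powR_rem2 eqxx.
rewrite -rem0; apply/continuous_withinNx; rewrite rem0.
(* The values at 0 are chosen so that [df 0 / dg 0] is already the expected limit; the limit of
   [df / dg] over full neighbourhoods of 0 then reduces to a punctured one. *)
pose df (v : R) := if v == 0 then a * (a - 1) / 2 else a * (1 + v) `^ (a - 1) - a.
pose dg (v : R) := if v == 0 then 1 else 2 * v.
have Df (x : R) : -1 < x ->
    is_derive x 1 (fun v : R => (1 + v) `^ a - 1 - a * v) (a * (1 + x) `^ (a - 1) - a).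
  move=> x1; have := is_deriveB (is_deriveB (is_derive1_powR1D a x1)
    (is_derive_cst (1 : R) x 1)) (is_deriveZ a (is_derive_id x (1 : R))).
  by rewrite subr0 /GRing.scale /= mulr1.
have Dg (x : R) : is_derive x 1 (fun v : R => v ^+ 2) (2 * x).
  have := is_deriveX 2 (is_derive_id x (1 : R)).
  by rewrite /GRing.scale /= expr1 mulr1.
have cf : (1 + v) `^ a - 1 - a * v @[v --> (0 : R)] --> (0 : R).
  have D0 : is_derive (0 : R) 1 (fun v : R => (1 + v) `^ a - 1 - a * v)
      (a * (1 + 0) `^ (a - 1) - a).
    by apply: Df; rewrite ltrN10.
  have /derivable1_diffP/differentiable_continuous := @ex_derive _ _ _ _ _ _ _ D0.
  by rewrite /prop_for /continuous_at /= addr0 powR1 mulr0 subrr subr0.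
have cg : v ^+ 2 @[v --> (0 : R)] --> (0 : R).
  have /derivable1_diffP/differentiable_continuous := @ex_derive _ _ _ _ _ _ _ (Dg 0).
  by rewrite /prop_for /continuous_at expr0n.
have : ((1 + v) `^ a - 1 - a * v) / v ^+ 2 @[v --> (0:R)^'] --> a * (a - 1) / 2.
  apply: (@lhopital R (fun v => (1 + v) `^ a - 1 - a * v) df
    (fun v => v ^+ 2) dg (-1) 1 0) => //.
  - by rewrite in_itv /=; lra.
  - move=> x; rewrite inE /= in_itv /= => -[/andP[x1 _] /eqP x0].
    by rewrite /df (negbTE x0); exact: Df.
  - move=> x; rewrite inE /= in_itv /= => -[_ /eqP x0].
    by rewrite /dg (negbTE x0); exact: Dg.
  - move=> x; rewrite inE /= in_itv /= => -[_ /eqP x0].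
    by rewrite /dg (negbTE x0) mulf_neq0.
  - have h0 : df 0 / dg 0 = a * (a - 1) / 2 by rewrite /df /dg eqxx divr1.
    rewrite -h0; apply/(@continuous_withinNx R R (fun v => df v / dg v)); rewrite h0.
    have D0 : is_derive (0 : R) 1 (fun v : R => (1 + v) `^ (a - 1)) (a - 1).
      have x1 : -1 < 0 :> R by rewrite ltrN10.
      by have := is_derive1_powR1D (a - 1) x1; rewrite addr0 powR1 mulr1.
    have := @ex_derive _ _ _ _ _ _ _ D0; rewrite /derivable => D.
    have : a / 2 * (h^-1 *: ((1 + (h *: 1 + 0)) `^ (a - 1) - (1 + 0) `^ (a - 1)))
       @[h --> (0 : R)^'] --> a / 2 * (a - 1).
      apply: cvgMl_tmp.
      rewrite -[X in _ --> X](@derive_val _ _ _ _ _ _ _ D0).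
      exact: D.
    rewrite mulrAC; apply: cvg_trans; apply: near_eq_cvg; near=> h.
    have h1 : h != 0 by near: h; exact: nbhs_dnbhs_neq.
    rewrite /df /dg (negbTE h1) !addr0 powR1 /GRing.scale /= mulr1.
    by field.
apply: cvg_trans; apply: near_eq_cvg; near=> v.
rewrite /powR_rem2 ifF//; apply/negbTE; near: v.
exact: nbhs_dnbhs_neq.
Unshelve. all: by end_near. Qed.

(** * Product kernels affine in a parameter *)

(** Common form of both regimes: [c] is the one-coordinate law at [t = 0] (point mass at 0, or
    uniform) and [d] its direction of change. *)
Definition mixture (R : realType) (p n : nat) (c d : 'Z_p -> R) (t : R)
    (f : {ffun cube p n -> bool}) (x : cube p n) : R :=
  \sum_(z : cube p n) (\prod_i (c (z i) + t * d (z i))) * bR R f (x + z).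

(** The derivative of [mixture] in [t] at 0, by the product rule applied to the kernel. *)
Definition mixture_slope (R : realType) (p n : nat) (c d : 'Z_p -> R)
    (f : {ffun cube p n -> bool}) (x : cube p n) : R :=
  \sum_(z : cube p n) (\sum_(i < n) d (z i) * \prod_(j | j != i) c (z j)) * bR R f (x + z).

Lemma cvg_mixture (R : realType) (p n : nat) (c d : 'Z_p -> R)
    (f : {ffun cube p n -> bool}) (x : cube p n) :
  (mixture c d t f x - mixture c d 0 f x) / t @[t --> (0 : R)^'+] -->
  mixture_slope c d f x.
Proof.
have -> : (fun t => (mixture c d t f x - mixture c d 0 f x) / t) =
    (fun t => \sum_(z : cube p n) ((\prod_i (c (z i) + t * d (z i)) - \prod_(i < n) c (z i)) / t)
      * bR R f (x + z)).
  apply/funext => t; rewrite -sumrB mulr_suml; apply: eq_bigr => z _.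
  by under [X in _ - X * _]eq_bigr do rewrite mul0r addr0; ring.
apply: cvg_sumr => z _; apply: cvgMr_tmp.
apply: cvg_dslope_prod_affine; exact: index_enum_uniq.
Qed.

Lemma card_cube (p n : nat) : (1 < p)%N -> #|cube p n| = (p ^ n)%N.
Proof. by move=> p1; rewrite card_ffun !card_ord Zp_cast. Qed.

Lemma sum_translate (R : realType) (p n : nat) (g : cube p n -> R) (z : cube p n) :
  \sum_(x : cube p n) g (x + z) = \sum_(x : cube p n) g x.
Proof. by rewrite [RHS](reindex_inj (addIr z)). Qed.

Lemma unitvE (p n : nat) (i j : 'I_n) (a : 'Z_p) :
  unitv i a j = if j == i then a else 0.
Proof. by rewrite ffunE. Qed.

(** * Small noise and total influence *)

(** Derivative in [eps] of the one-coordinate noise law: mass leaves 0 at rate 1 and spreads evenly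
    over the nonzero residues. *)
Definition flip_rate (R : realType) (p : nat) (a : 'Z_p) : R :=
  if a == 0 then -1 else (p.-1)%:R^-1.

Lemma TnoiseE_small (R : realType) (p n : nat) (eps : R)
    (f : {ffun cube p n -> bool}) (x : cube p n) :
  Tnoise eps f x = mixture (fun a => (a == 0)%:R) (@flip_rate R p) eps f x.
Proof.
apply: eq_bigr => z _; congr (_ * _); apply: eq_bigr => i _.
by rewrite /flip_rate; case: eqP => _; rewrite /=; ring.
Qed.

Lemma prod_delta (R : realType) (I : finType) (P : pred I) (b : I -> bool) :
  \prod_(i | P i) ((b i)%:R : R) = [forall (i | P i), b i]%:R.
Proof.
case: forallP => [b1|/forallP].
  by apply: big1 => i Pi; have := b1 i; rewrite Pi => /= ->.
rewrite negb_forall => /existsP[i]; rewrite negb_imply => /andP[Pi /negbTE bi].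
by rewrite (bigD1 i) //= bi mul0r.
Qed.

Lemma mixture_delta0 (R : realType) (p n : nat) (d : 'Z_p -> R)
    (f : {ffun cube p n -> bool}) (x : cube p n) :
  mixture (fun a => (a == 0)%:R) d 0 f x = bR R f x.
Proof.
rewrite /mixture (bigD1 (0 : cube p n)) //= addr0 [X in _ + X]big1 ?addr0 => [|z z0].
  by rewrite big1 ?mul1r // => i _; rewrite ffunE eqxx mul0r addr0.
have [i zi] : exists i, z i != 0.
  apply/existsP; rewrite -negb_forall; apply: contra z0 => /forallP z0.
  by apply/eqP/ffunP => i; rewrite ffunE; apply/eqP.
by rewrite (bigD1 i) //= (negbTE zi) mul0r addr0 !mul0r.
Qed.

(** The product of point masses over [j != i] keeps only shifts [z] supported on coordinate [i], so
    the sum over the cube collapses to one over residues. *)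
Lemma mixture_slope_delta (R : realType) (p n : nat) (d : 'Z_p -> R)
    (f : {ffun cube p n -> bool}) (x : cube p n) :
  mixture_slope (fun a => (a == 0)%:R) d f x =
  \sum_(i < n) \sum_a d a * bR R f (x + unitv i a).
Proof.
rewrite /mixture_slope; under eq_bigr do rewrite mulr_suml.
rewrite exchange_big; apply: eq_bigr => i _.
under eq_bigr => z _.
  rewrite prod_delta (_ : [forall (j | j != i), z j == 0] = (z == unitv i (z i))); last first.
    apply/forallP/eqP => [zi|-> j]; last by rewrite unitvE; case: eqP.
    apply/ffunP => j; rewrite unitvE; case: eqP => [->//|/eqP ji].
    by have := zi j; rewrite ji => /eqP.
  rewrite (_ : _ * _ = if z == unitv i (z i) then d (z i) * bR R f (x + z) else 0); last first.
    by case: ifP; rewrite ?mulr1// mulr0 mul0r.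
  over.
rewrite -big_mkcond (reindex_onto (unitv i) (fun z : cube p n => z i)) /=; last first.
  by move=> z /eqP.
by apply: eq_big => [a|a _]; rewrite unitvE eqxx // !eqxx.
Qed.

Lemma card_Zp_neq0 (p : nat) : (1 < p)%N -> #|[pred a : 'Z_p | a != 0]| = p.-1.
Proof.
move=> p1; rewrite -[in RHS](Zp_cast p1) -[in RHS](card_ord (Zp_trunc p).+2).
by rewrite -(cardC1 (0 : 'Z_p)); apply: eq_card.
Qed.

(** The weight -1 at 0 is shared out among the [p.-1] nonzero residues, one copy of [g 0] for
    each. *)
Lemma sum_flip_rate (R : realType) (p : nat) (g : 'Z_p -> R) : (1 < p)%N ->
  \sum_a flip_rate R a * g a = (p.-1)%:R^-1 * \sum_(a | a != 0) (g a - g 0).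
Proof.
move=> p1; have q0 : (p.-1)%:R != 0 :> R by rewrite pnatr_eq0 -lt0n -subn1 subn_gt0.
rewrite (bigD1 0) //= /flip_rate eqxx sumrB sumr_const card_Zp_neq0 //.
under eq_bigr => a a0 do rewrite (negbTE a0).
rewrite -mulr_sumr -[g 0 *+ _]mulr_natl; field.
exact: q0.
Qed.

Lemma total_influenceE (R : realType) (p n : nat) (f : {ffun cube p n -> bool}) :
  (1 < p)%N ->
  Ex (fun x => bR R f x * mixture_slope (fun a => (a == 0)%:R) (@flip_rate R p) f x)
  = - (total_influence R f / 2).
Proof.
move=> p1; rewrite /total_influence /influence_j /Ex -mulr_sumr -mulrA -mulrN; congr (_ * _).
have -> : \sum_(j < n) \sum_(x : cube p n) (p.-1)%:R^-1 *
      (\sum_(a : 'Z_p | a != 0) (f x != f (x + unitv j a))%:R) =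
    \sum_j \sum_(a : 'Z_p | a != 0) (p.-1)%:R^-1 *
      (- 2 * \sum_(x : cube p n) bR R f x * (bR R f (x + unitv j a) - bR R f x)).
  apply: eq_bigr => j _; rewrite -mulr_sumr exchange_big mulr_sumr.
  apply: eq_bigr => a _; congr (_ * _).
  (* For values in {0, 1}, the indicator of disagreement is the square of the difference. *)
  transitivity (\sum_(x : cube p n) (bR R f x * bR R f x - 2 * (bR R f x * bR R f (x + unitv j a))
      + bR R f (x + unitv j a) * bR R f (x + unitv j a))).
    by apply: eq_bigr => x _; rewrite /bR; case: (f x); case: (f _) => /=; ring.
  (* Translation invariance replaces the shifted square by the unshifted one, which leaves -2 times
     [f] against its increment. *)
  rewrite big_split /= (sum_translate (fun x => bR R f x * bR R f x)) -big_split /= mulr_sumr.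
  by apply: eq_bigr => x _; ring.
have -> : \sum_(x : cube p n) bR R f x * mixture_slope (fun a => (a == 0)%:R) (@flip_rate R p) f x =
  \sum_j \sum_(a : 'Z_p | a != 0) (p.-1)%:R^-1 *
      \sum_(x : cube p n) bR R f x * (bR R f (x + unitv j a) - bR R f x).
  transitivity (\sum_(x : cube p n) \sum_j (p.-1)%:R^-1 * \sum_(a : 'Z_p | a != 0)
      bR R f x * (bR R f (x + unitv j a) - bR R f x)).
    apply: eq_bigr => x _; rewrite mixture_slope_delta mulr_sumr; apply: eq_bigr => j _.
    rewrite sum_flip_rate // (_ : unitv j 0 = 0); last first.
      by apply/ffunP => i; rewrite unitvE ffunE if_same.
    by rewrite addr0 mulrCA -mulr_sumr.
  rewrite exchange_big; apply: eq_bigr => j _.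
  by rewrite -mulr_sumr exchange_big mulr_sumr.
rewrite mulr_suml -sumrN; apply: eq_bigr => j _.
rewrite mulr_suml -sumrN; apply: eq_bigr => a _.
by field; rewrite pnatr_eq0 -lt0n -subn1 subn_gt0.
Qed.

(** * Powers of functions with a known slope *)

(** [u] may take the value 0, so the right limit of the power at 0 is first extended to the closed
    half-line, on which the power vanishes at 0 because [0 < a]. *)
Lemma cvg_powR0 (R : realType) (T : Type) (F : set_system T) {FF : Filter F}
    (u : T -> R) (a : R) : 0 < a -> (\forall t \near F, 0 <= u t) ->
  u t @[t --> F] --> (0 : R) -> u t `^ a @[t --> F] --> (0 : R).
Proof.
move=> a0 u_ge0 u0.
have : x `^ a @[x --> within (fun y => 0 <= y) (nbhs (0 : R))] --> 0 `^ a.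
  by apply: cvg_at_right_within; rewrite powR0 ?gt_eqF//; exact: powR_cvg0.
rewrite powR0 ?gt_eqF//; apply: (@cvg_comp _ _ _ u (@powR R ^~ a)) => A hA.
by have := u0 _ hA; apply: filterS2 u_ge0 => t ut; exact.
Qed.

Lemma cvg_dslope_powR_bool (R : realType) (u : R -> R) (a d : R) (b : bool) :
  1 < a -> (\forall t \near (0 : R)^'+, 0 <= u t) ->
  (u t - b%:R) / t @[t --> (0 : R)^'+] --> d ->
  (u t `^ a - b%:R) / t @[t --> (0 : R)^'+] --> a * (b%:R * d).
Proof.
move=> a1 u_ge0 ud.
have ub : u t @[t --> (0 : R)^'+] --> (b%:R : R).
  exact: (cvg_dslope (near_neq0_at_right R) (@cvg_id_at_right R) ud).
case: b ud ub => /= ud ub; last first.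
  rewrite mul0r mulr0.
  have ua : u t `^ (a - 1) @[t --> (0 : R)^'+] --> (0 : R).
    by apply: cvg_powR0 => //; rewrite subr_gt0.
  (* When [b] is false, one factor [u t] is split off the power: its slope tends to [d], and the
     rest, of exponent [a - 1 > 0], tends to 0. *)
  have : (u t - 0) / t * u t `^ (a - 1) @[t --> (0 : R)^'+] --> d * 0 by exact: cvgM.
  rewrite mulr0; apply: cvg_trans; apply: near_eq_cvg; near=> t.
  have ut : 0 <= u t by near: t.
  by rewrite !subr0 -(mulr_powRB1 ut (lt_trans ltr01 a1)) mulrAC.
rewrite mul1r.
have v0 : u t - 1 @[t --> (0 : R)^'+] --> (0 : R).
  by rewrite -[X in _ --> X](subrr 1); apply: cvgB => //; exact: cvg_cst.
have rv : powR_rem2 a (u t - 1) @[t --> (0 : R)^'+] --> a * (a - 1) / 2.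
  exact: (cvg_comp _ _ v0 (@cvg_powR_rem2 R a)).
(* When [b] is true, this is the Taylor expansion at 1 divided by [t]; the quadratic term keeps a
   factor [u t - 1] that tends to 0. *)
have : a * ((u t - 1) / t) + powR_rem2 a (u t - 1) * ((u t - 1) / t * (u t - 1))
    @[t --> (0 : R)^'+] --> a * d + a * (a - 1) / 2 * (d * 0).
  by apply: cvgD; [exact: cvgMl_tmp|apply: cvgM => //; exact: cvgM].
rewrite !mulr0 addr0; apply: cvg_trans; apply: near_eq_cvg; near=> t.
have t0 : t != 0 by near: t; exact: near_neq0_at_right.
rewrite -[in RHS](subrK 1 (u t)) [in RHS](addrC (u t - 1)) powR1D.
by field.
Unshelve. all: by end_near. Qed.

(** Writing [u t = m * (1 + v)] with [v = (u t - m) / m] reduces to the expansion at 1; once the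
    linear term is removed, only [powR_rem2 a v * v ^+ 2] remains, and [v / t] tends to [l / m]. *)
Lemma cvg_dslope2_powR (R : realType) (u : R -> R) (a m l : R) : 0 < m ->
  (u t - m) / t @[t --> (0 : R)^'+] --> l ->
  (u t `^ a - m `^ a - a * m `^ a * ((u t - m) / m)) / t ^+ 2
    @[t --> (0 : R)^'+] --> m `^ a * (a * (a - 1) / 2) * (l / m) ^+ 2.
Proof.
move=> m0 ul; have mN0 : m != 0 by rewrite gt_eqF.
have um : u t @[t --> (0 : R)^'+] --> m.
  exact: (cvg_dslope (near_neq0_at_right R) (@cvg_id_at_right R) ul).
have v0 : (u t - m) / m @[t --> (0 : R)^'+] --> (0 : R).
  rewrite -[X in _ --> X](mul0r m^-1); apply: cvgMr_tmp.
  by rewrite -[X in _ --> X](subrr m); apply: cvgB => //; exact: cvg_cst.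
have rv : powR_rem2 a ((u t - m) / m) @[t --> (0 : R)^'+] --> a * (a - 1) / 2.
  exact: (cvg_comp _ _ v0 (@cvg_powR_rem2 R a)).
have : m `^ a * powR_rem2 a ((u t - m) / m) * ((u t - m) / t / m) ^+ 2
    @[t --> (0 : R)^'+] --> m `^ a * (a * (a - 1) / 2) * (l / m) ^+ 2.
  have ulm : (u t - m) / t / m @[t --> (0 : R)^'+] --> l / m by exact: cvgMr_tmp.
  by apply: cvgM; [exact: cvgMl_tmp|apply: cvgM].
apply: cvg_trans; apply: near_eq_cvg; near=> t.
have t0 : t != 0 by near: t; exact: near_neq0_at_right.
(* Positivity lets the power of the product [m * (1 + v)] be split. *)
have ut : 0 < u t by near: t; exact: (cvgr_gt _ um).
have um1 : u t = m * (1 + (u t - m) / m) by field.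
rewrite [X in X `^ a - _]um1 powRM ?ltW//; last first.
  by rewrite -(pmulr_rgt0 _ m0) -um1.
rewrite powR1D; move: (powR_rem2 _ _) => r.
by field; rewrite t0 mN0.
Unshelve. all: by end_near. Qed.

(** * Noise near the uniform law, and preservation of the mean *)

Lemma TnoiseE_large (R : realType) (p n : nat) (rho : R)
    (f : {ffun cube p n -> bool}) (x : cube p n) : (1 < p)%N ->
  Tnoise ((1 - p%:R^-1) * (1 - rho)) f x =
  mixture (fun=> p%:R^-1) (fun a => (a == 0)%:R - p%:R^-1) rho f x.
Proof.
move=> p1; have q0 : p.-1%:R != 0 :> R by rewrite pnatr_eq0 -lt0n -subn1 subn_gt0.
(* Expressing [p] through [p.-1] leaves a single unknown for [field]. *)
have pE : p%:R = p.-1%:R + 1 :> R by rewrite -(natrD _ p.-1 1) addn1 prednK// ltnW.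
have p0 : p.-1%:R + 1 != 0 :> R by rewrite -pE pnatr_eq0 -lt0n ltnW.
apply: eq_bigr => z _; congr (_ * _); apply: eq_bigr => i _; rewrite pE.
by case: eqP => _ /=; field; rewrite ?q0 ?p0.
Qed.

Lemma Tnoise_ge0 (R : realType) (p n : nat) (eps : R)
    (f : {ffun cube p n -> bool}) (x : cube p n) : 0 <= eps <= 1 ->
  0 <= Tnoise eps f x.
Proof.
move=> /andP[e0 e1]; apply: sumr_ge0 => z _; apply: mulr_ge0; last by rewrite ler0n.
apply: prodr_ge0 => i _; case: ifP => _; first by rewrite subr_ge0.
by rewrite divr_ge0// ler0n.
Qed.

(** The total mass of the product kernel factors over coordinates into ones, and each translate of
    [f] has the same sum. *)
Lemma sum_mixture (R : realType) (p n : nat) (c d : 'Z_p -> R) (t : R)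
    (f : {ffun cube p n -> bool}) : \sum_a (c a + t * d a) = 1 ->
  \sum_(x : cube p n) mixture c d t f x = \sum_(x : cube p n) bR R f x.
Proof.
move=> cd1; rewrite /mixture exchange_big /=.
under eq_bigr => z _ do rewrite -mulr_sumr (sum_translate (bR R f)).
rewrite -mulr_suml -(bigA_distr_bigA (fun (i : 'I_n) a => c a + t * d a)) /=.
by rewrite big1 ?mul1r.
Qed.

Lemma sum_delta_sub (R : realType) (p : nat) (b : 'Z_p) : (1 < p)%N ->
  \sum_(a : 'Z_p) ((a == b)%:R - p%:R^-1 : R) = 0.
Proof.
move=> p1; rewrite sumrB (bigD1 b) //= eqxx big1 ?addr0 => [|a /negbTE->//].
rewrite sumr_const card_ord Zp_cast// -[p%:R^-1 *+ _]mulr_natl mulfV ?subrr//.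
by rewrite pnatr_eq0 -lt0n ltnW.
Qed.

Lemma sum_uniform (R : realType) (p : nat) : (1 < p)%N ->
  \sum_(a : 'Z_p) (p%:R^-1 : R) = 1.
Proof.
move=> p1; rewrite sumr_const card_ord Zp_cast// -[p%:R^-1 *+ _]mulr_natl mulfV//.
by rewrite pnatr_eq0 -lt0n ltnW.
Qed.

Lemma mixture_uniform0 (R : realType) (p n : nat) (d : 'Z_p -> R)
    (f : {ffun cube p n -> bool}) (x : cube p n) : (1 < p)%N ->
  mixture (fun=> p%:R^-1) d 0 f x = Ex (bR R f).
Proof.
move=> p1; rewrite /mixture /Ex card_cube//.
under eq_bigr => z _ do under eq_bigr do rewrite mul0r addr0.
under eq_bigr => z _ do rewrite prodr_const card_ord addrC.
by rewrite -mulr_sumr (sum_translate (bR R f)) natrX exprVn.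
Qed.

(** * Leading terms of the noise objective *)

Lemma cvg_noise_obj_small (R : realType) (p n : nat) (alpha : R)
    (f : {ffun cube p n -> bool}) : (1 < p)%N -> 1 < alpha ->
  (noise_obj t alpha f - Ex (bR R f)) / t @[t --> (0 : R)^'+] -->
  alpha * - (total_influence R f / 2).
Proof.
move=> p1 a1; rewrite -total_influenceE// /Ex mulrCA [alpha * _]mulr_sumr.
have -> : (fun t => (noise_obj t alpha f - #|cube p n|%:R^-1 * \sum_x bR R f x) / t) =
  (fun t => #|cube p n|%:R^-1 * \sum_x (Tnoise t f x `^ alpha - bR R f x) / t).
  by apply/funext => t; rewrite -mulrBr -sumrB -mulrA mulr_suml.
apply: cvgMl_tmp; apply: cvg_sumr => x _; apply: cvg_dslope_powR_bool => //.
  near=> t; apply: Tnoise_ge0; apply/andP; split.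
    by rewrite ltW//; near: t; exact: nbhs_right_gt.
  by rewrite ltW//; near: t; exact: nbhs_right_lt.
have := @cvg_mixture R p n (fun a : 'Z_p => (a == 0)%:R) (@flip_rate R p) f x.
under eq_cvg do rewrite mixture_delta0 -TnoiseE_small.
exact.
Unshelve. all: by end_near. Qed.

Lemma cvg_noise_obj_large (R : realType) (p n : nat) (alpha : R)
    (f : {ffun cube p n -> bool}) : (1 < p)%N -> let m := Ex (bR R f) in 0 < m ->
  (noise_obj ((1 - p%:R^-1) * (1 - t)) alpha f - m `^ alpha) / t ^+ 2
    @[t --> (0 : R)^'+] -->
  m `^ alpha * (alpha * (alpha - 1) / 2) / m ^+ 2 *
  Ex (fun x => mixture_slope (fun=> p%:R^-1) (fun a => (a == 0)%:R - p%:R^-1) f x ^+ 2).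
Proof.
move=> p1 m m0.
pose u (t : R) x := mixture (fun=> p%:R^-1) (fun a : 'Z_p => (a == 0)%:R - p%:R^-1) t f x.
have N0 : #|cube p n|%:R != 0 :> R.
  by rewrite card_cube// pnatr_eq0 -lt0n expn_gt0 ltnW.
have sum_m : \sum_(x : cube p n) m = \sum_(x : cube p n) bR R f x.
  by rewrite sumr_const -[LHS]mulr_natl mulrA mulfV// mul1r.
(* The mean is exactly [m] for every [t], so the linear Taylor term can be subtracted pointwise
   without changing the sum; this removes the term of order [t]. *)
have sum_u t : \sum_(x : cube p n) (u t x - m) = 0.
  rewrite sumrB sum_m sum_mixture ?subrr//.
  by rewrite big_split /= -mulr_sumr sum_uniform// sum_delta_sub// mulr0 addr0.
have -> : (fun t : R => (noise_obj ((1 - p%:R^-1) * (1 - t)) alpha f - m `^ alpha) / t ^+ 2) =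
  (fun t : R => #|cube p n|%:R^-1 * \sum_x (u t x `^ alpha - m `^ alpha
     - alpha * m `^ alpha * ((u t x - m) / m)) / t ^+ 2).
  apply/funext => t; rewrite -mulr_suml [in RHS]sumrB -mulr_sumr -mulr_suml sum_u.
  rewrite mul0r mulr0 subr0 mulrA sumrB sumr_const.
  rewrite -[m `^ alpha *+ _]mulr_natl [in RHS]mulrBr mulKf//.
  by under [in RHS]eq_bigr do rewrite /u -TnoiseE_large//.
rewrite /Ex mulrCA mulr_sumr; apply: cvgMl_tmp; apply: cvg_sumr => x _.
have -> (l : R) : m `^ alpha * (alpha * (alpha - 1) / 2) / m ^+ 2 * l ^+ 2 =
    m `^ alpha * (alpha * (alpha - 1) / 2) * (l / m) ^+ 2.
  by rewrite expr_div_n; ring.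
apply: cvg_dslope2_powR => //.
have := @cvg_mixture R p n (fun=> p%:R^-1) (fun a : 'Z_p => (a == 0)%:R - p%:R^-1) f x.
under eq_cvg do rewrite mixture_uniform0//.
exact.
Qed.

(** * Orthogonality of characters and the level-one weight *)

(** After multiplication by [2 * sin h] with [h = pi * k / q], the terms telescope: 2 sin(h)
    cos(2ah) = sin((2a+1)h) - sin((2a-1)h). *)
Lemma sum_cos_multiples (R : realType) (q k : nat) : (0 < k < q)%N ->
  \sum_(0 <= a < q) cos (2 * pi * (a * k)%:R / q%:R : R) = 0.
Proof.
move=> /andP[k0 kq]; have q0 : q%:R != 0 :> R by rewrite pnatr_eq0 -lt0n (ltn_trans k0).
pose h : R := pi * k%:R / q%:R.
(* Since [0 < k < q], the angle [h] lies strictly between 0 and [pi]. *)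
have h0 : sin h != 0.
  rewrite gt_eqF// sin_gt0_pi//; apply/andP; split.
    by rewrite !mulr_gt0 ?pi_gt0 ?ltr0n ?invr_gt0 ?ltr0n// (ltn_trans k0).
  rewrite /h -mulrA gtr_pMr ?pi_gt0// ltr_pdivrMr ?mul1r ?ltr_nat//.
  by rewrite ltr0n (ltn_trans k0).
apply: (mulfI (mulf_neq0 (_ : 2 != 0) h0)); first by rewrite pnatr_eq0.
rewrite mulr0 mulr_sumr.
rewrite (telescope_sumr_eq (fun a : nat => sin ((2 * a%:R - 1) * h)))//; last first.
  move=> a _; rewrite (_ : 2 * pi * (a * k)%:R / q%:R = 2 * a%:R * h); last first.
    by rewrite /h natrM; field.
  rewrite -(natr1 a).
  have -> : (2 * (a%:R + 1) - 1) * h = 2 * a%:R * h + h by ring.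
  have -> : (2 * a%:R - 1) * h = 2 * a%:R * h - h by ring.
  by rewrite sinD sinB; ring.
rewrite mulr0 sub0r mulN1r sinN opprK.
(* The last angle differs from the first, [- h], by [k] full turns, so the end terms cancel. *)
have -> : (2 * q%:R - 1) * h = - h + pi *+ 2 *+ k.
  by rewrite /h -[pi *+ 2 *+ k]mulr_natr -[pi *+ 2]mulr_natr; field.
by rewrite (periodicn (@sinD2pi R)) sinN addNr.
Qed.

Lemma sum_cos_orthogonal (R : realType) (p : nat) (b c : 'Z_p) : (1 < p)%N ->
  \sum_(a : 'Z_p) cos (2 * pi * (a * b)%N%:R / p%:R - 2 * pi * (a * c)%N%:R / p%:R : R)
  = p%:R * (b == c)%:R.
Proof.
move=> p1.
have lt_p (a : 'Z_p) : (a < p)%N by rewrite -[X in (_ < X)%N](Zp_cast p1).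
(* Subtraction of representatives in the naturals requires [e < d]; the opposite order follows
   because cosine is even. *)
have sum0 (d e : 'Z_p) : (e < d)%N ->
    \sum_(a : 'Z_p) cos (2 * pi * (a * d)%N%:R / p%:R - 2 * pi * (a * e)%N%:R / p%:R : R) = 0.
  move=> ed.
  under eq_bigr => a _ do
    rewrite -mulrBl -mulrBr -natrB ?leq_mul// ?(ltnW ed)// -mulnBr.
  rewrite -(big_mkord xpredT (fun a => cos (2 * pi * (a * (d - e))%N%:R / p%:R : R))).
  rewrite (_ : index_iota 0 _ = index_iota 0 p) ?Zp_cast//.
  rewrite sum_cos_multiples// subn_gt0 ed /=.
  by rewrite (leq_ltn_trans (leq_subr _ _)).
case: (ltngtP b c) => [bc|cb|/val_inj ->].
- rewrite (_ : b == c = false) ?mulr0; last by apply/eqP => bc'; rewrite bc' ltnn in bc.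
  by rewrite -[RHS](sum0 _ _ bc); apply: eq_bigr => a _; rewrite -cosN opprB.
- rewrite (_ : b == c = false) ?mulr0; last by apply/eqP => bc'; rewrite bc' ltnn in cb.
  exact: sum0.
- under eq_bigr do rewrite subrr cos0.
  by rewrite eqxx mulr1 sumr_const card_ord Zp_cast.
Qed.

Lemma fourier_sqE (R : realType) (p n : nat) (f : {ffun cube p n -> bool}) (xi : cube p n) :
  fourier_sq R f xi = #|cube p n|%:R^-1 ^+ 2 *
    \sum_(x : cube p n) \sum_(y : cube p n) bR R f x * bR R f y *
      cos (2 * pi * (dotn xi x)%:R / p%:R - 2 * pi * (dotn xi y)%:R / p%:R).
Proof.
rewrite /fourier_sq /Ex !exprMn -mulrDr; congr (_ * _).
rewrite !expr2 !big_distrlr -big_split /=; apply: eq_bigr => x _.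
by rewrite -big_split /=; apply: eq_bigr => y _; rewrite cosB; ring.
Qed.

Lemma dotn_unitv (p n : nat) (i : 'I_n) (a : 'Z_p) (x : cube p n) :
  dotn (unitv i a) x = (a * x i)%N.
Proof.
rewrite /dotn (bigD1 i) //= unitvE eqxx big1 ?addn0// => j /negbTE ji.
by rewrite unitvE ji.
Qed.

(** A vector with one-element support is determined by its position [i] and its nonzero entry
    [a]. *)
Lemma sum_supp1 (R : realType) (p n : nat) (F : cube p n -> R) :
  \sum_(xi : cube p n | #|supp xi| == 1%N) F xi =
  \sum_(i < n) \sum_(a : 'Z_p | a != 0) F (unitv i a).
Proof.
transitivity (\sum_(i < n) \sum_(xi : cube p n | supp xi == [set i]%SET) F xi).
  rewrite (exchange_big_dep (fun xi : cube p n => #|supp xi| == 1%N)) /=; last first.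
    by move=> i xi _ /eqP ->; rewrite cards1.
  apply: eq_bigr => xi /cards1P[i ->].
  rewrite (big_pred1 i)// => j; rewrite (inj_eq set1_inj) eq_sym //.
apply: eq_bigr => i _.
rewrite (reindex_onto (unitv i) (fun xi : cube p n => xi i)) /=; last first.
  move=> xi /eqP sxi; apply/ffunP => j; rewrite unitvE; case: eqP => [->//|/eqP ji].
  apply/esym/eqP; move/setP/(_ j): sxi; rewrite !inE (negbTE ji).
  by move=> /negbT; rewrite negbK.
apply: eq_bigl => a; rewrite unitvE eqxx eqxx andbT.
apply/eqP/idP => [/setP/(_ i)|a0]; first by rewrite !inE unitvE !eqxx.
by apply/setP => j; rewrite !inE unitvE; case: (j =P i) => // _; rewrite eqxx.
Qed.

(** The sum over [a != 0] is the full sum minus the term [a = 0]: orthogonality evaluates the former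
    as [p] times an equality indicator, and the latter contributes the 1. *)
Lemma W1E (R : realType) (p n : nat) (f : {ffun cube p n -> bool}) : (1 < p)%N ->
  W1 R f = #|cube p n|%:R^-1 ^+ 2 * \sum_(i < n)
    \sum_(x : cube p n) \sum_(y : cube p n) bR R f x * bR R f y *
      (p%:R * (x i == y i)%:R - 1).
Proof.
move=> p1; rewrite /W1 sum_supp1 mulr_sumr; apply: eq_bigr => i _.
have E (a : 'Z_p) : fourier_sq R f (unitv i a) = #|cube p n|%:R^-1 ^+ 2 *
    \sum_(x : cube p n) \sum_(y : cube p n) bR R f x * bR R f y *
      cos (2 * pi * (a * x i)%N%:R / p%:R - 2 * pi * (a * y i)%N%:R / p%:R).
  by rewrite fourier_sqE; under eq_bigr do under eq_bigr do rewrite !dotn_unitv.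
have -> : \sum_(a : 'Z_p | a != 0) fourier_sq R f (unitv i a) =
    \sum_(a : 'Z_p) fourier_sq R f (unitv i a) - fourier_sq R f (unitv i 0).
  by rewrite [X in X - _](bigD1 0) //= [RHS]addrC addKr.
under eq_bigr do rewrite E.
rewrite E -mulr_sumr -mulrBr exchange_big -sumrB; congr (_ * _).
apply: eq_bigr => x _; rewrite exchange_big -sumrB; apply: eq_bigr => y _ /=.
by rewrite -mulr_sumr sum_cos_orthogonal// subrr cos0 -mulrBr.
Qed.

(** * Second moment of the slope at the uniform law *)

(** Padding with factors 1 makes the summand a product over all coordinates, covering [i = j] and
    [i != j] at once. *)
Lemma sum_coord_mul (R : realType) (p n : nat) (g h : 'Z_p -> R) (i j : 'I_n) :
  \sum_(x : cube p n) g (x i) * h (x j) =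
  \prod_(k < n) \sum_(a : 'Z_p) (if k == i then g a else 1) * (if k == j then h a else 1).
Proof.
rewrite bigA_distr_bigA /=; apply: eq_bigr => x _.
rewrite big_split /= -!big_mkcond !big_pred1_eq //.
Qed.

Lemma sum_coord_mul_neq (R : realType) (p n : nat) (g h : 'Z_p -> R) (i j : 'I_n) :
  i != j -> \sum_a g a = 0 -> \sum_(x : cube p n) g (x i) * h (x j) = 0.
Proof.
move=> /negbTE ij g0; rewrite sum_coord_mul (bigD1 i)//= eqxx ij.
by under eq_bigr do rewrite mulr1; rewrite g0 mul0r.
Qed.

Lemma sum_coord_mul_eq (R : realType) (p n : nat) (g h : 'Z_p -> R) (i : 'I_n) :
  (1 < p)%N -> \sum_(x : cube p n) g (x i) * h (x i) =
  p%:R ^+ n.-1 * \sum_a g a * h a.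
Proof.
move=> p1; rewrite sum_coord_mul (bigD1 i)//= eqxx mulrC; congr (_ * _).
under eq_bigr => k /negbTE ki do
  rewrite ki mulr1 sumr_const card_ord Zp_cast//.
by rewrite prodr_const cardC1 card_ord.
Qed.

Lemma mixture_slope_uniform (R : realType) (p n : nat) (d : 'Z_p -> R)
    (f : {ffun cube p n -> bool}) (x : cube p n) :
  mixture_slope (fun=> p%:R^-1) d f x =
  p%:R^-1 ^+ n.-1 * \sum_(i < n) \sum_(y : cube p n) d (y i - x i) * bR R f y.
Proof.
rewrite /mixture_slope exchange_big /=.
rewrite (reindex_inj (addIr (- x))) /= mulr_sumr.
apply: eq_bigr => y _; rewrite [x + _]addrC subrK mulr_suml mulr_sumr.
apply: eq_bigr => i _; rewrite !ffunE prodr_const cardC1 card_ord.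
by ring.
Qed.

(** Both sides become sums over [i] and pairs of points of [f] against a kernel in the [i]-th
    coordinates; comparing kernels avoids complex characters. *)
Lemma Ex_sq_mixture_slope (R : realType) (p n : nat) (f : {ffun cube p n -> bool}) :
  (1 < p)%N -> (0 < n)%N ->
  Ex (fun x => mixture_slope (fun=> p%:R^-1) (fun a => (a == 0)%:R - p%:R^-1) f x ^+ 2)
  = W1 R f.
Proof.
move=> p1 n0; rewrite W1E//; have p0 : p%:R != 0 :> R by rewrite pnatr_eq0 -lt0n ltnW.
(* The centred point mass at [b]; [kk] shows that the Gram matrix of these functions is the centred
   identity. *)
pose k (b a : 'Z_p) : R := (a == b)%:R - p%:R^-1.
have kk b c : \sum_a k b a * k c a = (b == c)%:R - p%:R^-1.
  under eq_bigr do rewrite {1}/k mulrBl.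
  rewrite sumrB -mulr_sumr sum_delta_sub// mulr0 subr0.
  rewrite (bigD1 b)//= eqxx mul1r big1 ?addr0// => a /negbTE ->.
  by rewrite mul0r.
have f1E x : mixture_slope (fun=> p%:R^-1) (fun a => (a == 0)%:R - p%:R^-1) f x =
    p%:R^-1 ^+ n.-1 * \sum_(y : cube p n) \sum_(i < n) bR R f y * k (y i) (x i).
  rewrite mixture_slope_uniform exchange_big; congr (_ * _).
  apply: eq_bigr => y _; apply: eq_bigr => i _.
  by rewrite /k subr_eq0 eq_sym mulrC.
rewrite /Ex; under eq_bigr do rewrite f1E exprMn [X in _ * X]expr2 big_distrlr /=.
rewrite -mulr_sumr.
have -> : \sum_(x : cube p n) \sum_(y : cube p n) \sum_(z : cube p n)
      (\sum_(i < n) bR R f y * k (y i) (x i)) * (\sum_(i < n) bR R f z * k (z i) (x i)) =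
    p%:R ^+ n.-1 * p%:R^-1 * \sum_(i < n) \sum_(y : cube p n) \sum_(z : cube p n)
      bR R f y * bR R f z * (p%:R * (y i == z i)%:R - 1).
  rewrite [in RHS]exchange_big [in LHS]exchange_big mulr_sumr; apply: eq_bigr => y _.
  rewrite [in RHS]exchange_big [in LHS]exchange_big mulr_sumr; apply: eq_bigr => z _ /=.
  under eq_bigr do rewrite big_distrlr /=.
  rewrite exchange_big mulr_sumr; apply: eq_bigr => i _ /=.
  (* Only equal coordinates contribute: for [j != i] the sum factors through a centred function and
     vanishes. *)
  rewrite exchange_big (bigD1 i)//= [X in _ + X]big1 ?addr0 => [|j ji].
    under eq_bigr do rewrite mulrACA.
    by rewrite -mulr_sumr sum_coord_mul_eq// kk; field.
  under eq_bigr do rewrite mulrACA.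
  by rewrite -mulr_sumr sum_coord_mul_neq ?mulr0// 1?eq_sym// sum_delta_sub.
rewrite card_cube// natrX !mulrA; congr (_ * _).
have -> : p%:R ^+ n = p%:R ^+ n.-1 * p%:R :> R by rewrite -exprSr prednK.
have : p%:R ^+ n.-1 != 0 :> R by rewrite expf_neq0.
rewrite exprVn; move: (_ ^+ _) => P P0.
by field; rewrite P0 p0.
Qed.

(** * Comparison of leading coefficients *)

(** The midpoint of [L x] and [L y] eventually separates the two normalized values, and [s t > 0]
    preserves the order; finiteness of [X] gives one neighbourhood for all pairs. *)
Lemma near_strict_mono (R : realType) (X : finType) (P : X -> Prop)
    (Phi : R -> X -> R) (s : R -> R) (c : R) (L : X -> R) :
  (forall t, 0 < t -> 0 < s t) ->
  (forall x, P x -> (Phi t x - c) / s t @[t --> (0 : R)^'+] --> L x) ->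
  \forall t \near (0 : R)^'+,
    forall x y, P x -> P y -> L x < L y -> Phi t x < Phi t y.
Proof.
move=> s_gt0 PhiL; apply: filter_forall => x; apply: filter_forall => y.
have [Px|nPx] := pselect (P x); last by near=> t => /nPx.
have [Py|nPy] := pselect (P y); last by near=> t => _ /nPy.
have [Lxy|_] := ltP (L x) (L y); last by near=> t.
near=> t => _ _ _.
have st : 0 < s t by apply: s_gt0; near: t; exact: nbhs_right_gt.
have xt : (Phi t x - c) / s t < (L x + L y) / 2.
  by near: t; apply: (cvgr_lt _ (PhiL x Px)); rewrite midf_lt.
have yt : (L x + L y) / 2 < (Phi t y - c) / s t.
  by near: t; apply: (cvgr_gt _ (PhiL y Py)); rewrite midf_lt.
by have := lt_trans xt yt; rewrite ltr_pM2r ?invr_gt0// ltrD2r.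
Unshelve. all: by end_near. Qed.

Lemma near_at_right0P (R : realType) (Q : R -> Prop) :
  (\forall t \near (0 : R)^'+, Q t) ->
  exists2 d : R, 0 < d & forall t, 0 < t < d -> Q t.
Proof.
move=> [d /= d0 dQ]; exists d => // t /andP[t0 td].
by apply: dQ => //=; rewrite sub0r normrN gtr0_norm.
Qed.

Lemma Ex_bR_eq0 (R : realType) (p n : nat) (f : {ffun cube p n -> bool}) :
  (1 < p)%N -> Ex (bR R f) = 0 -> f = [ffun=> false].
Proof.
move=> p1 /eqP; rewrite mulf_eq0 invr_eq0 card_cube// pnatr_eq0 expn_eq0.
rewrite eqn0Ngt (ltnW p1) /= psumr_eq0 => [/allP f0|x _]; last by rewrite ler0n.
apply/ffunP => x; rewrite ffunE.
by have := f0 x (mem_index_enum x); rewrite /= pnatr_eq0 eqb0 => /negbTE.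
Qed.

Theorem theorem4 (R : realType) (p n : nat) (alpha : R) (j : nat) :
  (2 <= p)%N -> (1 <= n)%N -> 1 < alpha -> (j <= p ^ n)%N ->
  let m : R := j%:R / (p ^ n)%:R in
  (exists eps0 : R, 0 < eps0 /\ eps0 <= 1 - p%:R^-1 /\
     forall eps : R, 0 < eps < eps0 ->
     forall f : {ffun cube p n -> bool}, is_maximizer eps alpha m f ->
     forall g : {ffun cube p n -> bool}, Ex (bR R g) = m ->
       total_influence R f <= total_influence R g)
  /\
  (exists eps1 : R, 0 <= eps1 /\ eps1 < 1 - p%:R^-1 /\
     forall eps : R, eps1 < eps < 1 - p%:R^-1 ->
     forall f : {ffun cube p n -> bool}, is_maximizer eps alpha m f ->
     forall g : {ffun cube p n -> bool}, Ex (bR R g) = m ->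
       W1 R g <= W1 R f).
Proof.
move=> p1 n0 a1 _ m.
have a0 : 0 < alpha by exact: lt_trans a1.
have p0 : 0 < 1 - p%:R^-1 :> R.
  by rewrite subr_gt0 invf_lt1 ?ltr1n ?ltr0n// ltnW.
split.
- have lim (f : {ffun cube p n -> bool}) : Ex (bR R f) = m ->
      (noise_obj t alpha f - m) / t @[t --> (0 : R)^'+] -->
      alpha * - (total_influence R f / 2).
    by move=> <-; exact: cvg_noise_obj_small.
  have [d d0 small] := near_at_right0P (near_strict_mono
    (s := id) (fun t t0 => t0) lim).
  (* The minimum keeps [eps] in the admissible noise range. *)
  exists (Num.min d (1 - p%:R^-1)); split; first by rewrite lt_min d0.
  split=> [|eps /andP[eps0]]; first by rewrite ge_min lexx orbT.
  rewrite lt_min => /andP[epsd _] f [fm fmax] g gm.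
  (* The leading coefficient decreases with influence, so a competitor of smaller influence would
     have a strictly larger objective. *)
  rewrite leNgt; apply/negP => gf.
  suff : noise_obj eps alpha f < noise_obj eps alpha g by rewrite ltNge fmax.
  apply: small => //; first by rewrite eps0.
  by rewrite ltr_pM2l// ltrN2 ltr_pM2r.
have [m0|m_neq0] := eqVneq m 0.
  exists 0; split=> //; split=> // eps _ f [fm _] g gm.
  by rewrite m0 in fm gm; rewrite (Ex_bR_eq0 p1 fm) (Ex_bR_eq0 p1 gm).
have m0 : 0 < m by rewrite lt0r m_neq0 divr_ge0.
pose C := m `^ alpha * (alpha * (alpha - 1) / 2) / m ^+ 2.
have C0 : 0 < C.
  rewrite divr_gt0 ?exprn_gt0// mulr_gt0 ?powR_gt0// divr_gt0// mulr_gt0//.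
  by rewrite subr_gt0.
have lim (f : {ffun cube p n -> bool}) : Ex (bR R f) = m ->
    (noise_obj ((1 - p%:R^-1) * (1 - t)) alpha f - m `^ alpha) / t ^+ 2
      @[t --> (0 : R)^'+] --> C * W1 R f.
  move=> fm; rewrite -Ex_sq_mixture_slope// /C -fm.
  by apply: cvg_noise_obj_large => //; rewrite fm.
have [d d0 large] := near_at_right0P (near_strict_mono
  (s := fun t => t ^+ 2) (fun t t0 => exprn_gt0 2 t0) lim).
(* The noise level at [t = Num.min d 1]; the cap at 1 keeps it nonnegative. *)
exists ((1 - p%:R^-1) * (1 - Num.min d 1)); split.
  by apply: mulr_ge0; [exact: ltW | rewrite subr_ge0 ge_min lexx orbT].
split; first by rewrite gtr_pMr// gtrBl lt_min d0 ltr01.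
move=> eps /andP[eps1 epsp] f [fm fmax] g gm.
(* Inverse of the change of variable: the window for [eps] becomes [0 < t < Num.min d 1]. *)
pose t := 1 - eps / (1 - p%:R^-1).
have epsE : eps = (1 - p%:R^-1) * (1 - t).
  by rewrite /t subKr mulrC divfK// gt_eqF.
rewrite leNgt; apply/negP => fg.
suff : noise_obj eps alpha f < noise_obj eps alpha g by rewrite ltNge fmax.
rewrite epsE; apply: large => //; last by rewrite ltr_pM2l.
rewrite /t subr_gt0 ltr_pdivrMr// mul1r epsp /=.
move: eps1; rewrite -ltr_pdivlMl// mulrC ltrBlDr addrC -ltrBlDr.
by rewrite lt_min => /andP[].
Qed.
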